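(* Let $g\geq 1$ be an integer (with $g\ge 2$ in parts 1(a) and 2(a)), and let $t$ denote an integer not appearing in the arrays $P$, $Q_0$, $Q_1$ below. 1. (Construction C1) (a) If $P$ is a $g\times g$ $1$-PDA, then $\{P,\pi_{D,1}(P)\}$ is Blackburn-compatible w.r.t. $I_g(t)$ and $\{P,\pi_{AD,1}(P)\}$ is Blackburn-compatible w.r.t. $\tilde I_g(t)$. (b) For $P=J_g([g^2])$, $\mathcal{P}_D=\{P,\pi_{D,1}(P),\dots,\pi_{D,1}^{g-1}(P)\}$ is a set of $g$ $1$-PDAs Blackburn-compatible w.r.t. $I_g(t)$, and $\mathcal{P}_{AD}=\{P,\pi_{AD,1}(P),\dots,\pi_{AD,1}^{g-1}(P)\}$ is a set of $g$ $1$-PDAs Blackburn-compatible w.r.t. $\tilde I_g(t)$. (c) $L_{\mathcal{P}_D,I_g}(I_g)$ and $L_{\mathcal{P}_{AD},\tilde I_g}(I_g)$ are $g$-regular $(g^2,g^2,g^2-2g+1,g(2g-1))$ PDAs. 2. (Construction C2) Let $Q_0=G_{2g}([g(2g-1)])$ and $Q_1=H_{2g}([g(2g-1)])$. (a) $\{Q_0,\pi_{D,2}(Q_0)\}$ is Blackburn-compatible w.r.t. $I_{2g}(t)$, and $\{Q_1,\pi_{AD,2}(Q_1)\}$ is Blackburn-compatible w.r.t. $\tilde I_{2g}(t)$. (b) $\mathcal{Q}_D=\{Q_0,\pi_{D,2}(Q_0),\dots,\pi_{D,2}^{g-1}(Q_0)\}$ is a set of $g$ $2$-PDAs Blackburn-compatible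 w.r.t. $I_{2g}(t)$, and $\mathcal{Q}_{AD}=\{Q_1,\pi_{AD,2}(Q_1),\dots,\pi_{AD,2}^{g-1}(Q_1)\}$ is a set of $g$ $2$-PDAs Blackburn-compatible w.r.t. $\tilde I_{2g}(t)$. (c) $L_{\mathcal{Q}_D,I_{2g}}(I_g)$ and $L_{\mathcal{Q}_{AD},\tilde I_{2g}}(I_g)$ are $2g$-regular $(2g^2,2g^2,2g^2-3g+2,g(3g-2))$ PDAs.
   Context: Notation: $[n]=\{0,1,\dots,n-1\}$; rows and columns are indexed from $0$. For positive integers $K,f$, a nonnegative integer $Z$ and a finite set $\mathcal{S}$ of integers, a $(K,f,Z,\mathcal{S})$ placement delivery array (PDA) is an $f\times K$ array $P=[p_{j,k}]$ with entries in $\mathcal{S}\cup\{\ast\}$ such that: (C1) $\ast$ appears exactly $Z$ times in each column; (C2) each $s\in\mathcal{S}$ occurs at least once; (C3, Blackburn property) if two distinct cells $(j_1,k_1)$, $(j_2,k_2)$ contain the same integer then $p_{j_1,k_2}=p_{j_2,k_1}=\ast$. It is $g$-regular (a $g$-PDA) if each integer of $\mathcal{S}$ occurs exactly $g$ times. A number $S$ in place of the set means the integer set has $S$ elements. Blackburn compatibility: for arrays $P_0,P_1,P_\ast$ of the same size with entries integers or $\ast$, $P_0$ and $P_1$ are Blackburn-compatible w.r.t. $P_\ast$ if, whenever $p^{(0)}_{i_1j_1}=p^{(1)}_{i_2j_2}\neq\ast$, we have $p^{(\ast)}_{i_1j_2}=p^{(\ast)}_{i_2j_1}=\ast$. A family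 is Blackburn-compatible w.r.t. $P_\ast$ if any two different members of the family are. Special arrays: $I_n(t)$ (resp. $\tilde I_n(t)$) is the $n\times n$ array with $t$ on the main diagonal (resp. anti-diagonal) and $\ast$ elsewhere. $J_n([n^2])$ is the $n\times n$ array filled row-wise with the distinct integers $0,\dots,n^2-1$. $H_n(\mathcal{S})$ with $|\mathcal{S}|=n(n-1)/2$ is the symmetric $n\times n$ array with $\ast$ on the diagonal and the distinct integers of $\mathcal{S}$ filled row-wise below the diagonal (reflected across the diagonal above it). $G_n(\mathcal{S})$ is the $n\times n$ array with $\ast$ on the anti-diagonal, the distinct integers of $\mathcal{S}$ filled row-wise above the anti-diagonal, and reflected across the anti-diagonal below it. Rotations: for an $n\times n$ array $P$, $\pi_{D,1}(P)$ equals $P$ except that the diagonal entries are cyclically shifted down by one position (entry at $(i,i)$ moves to $(i+1,i+1)$ mod $n$); $\pi_{AD,1}(P)$ equals $P$ except that the anti-diagonal entry at $(i,j)$ moves to $(i-1,j+1)$ mod $n$. Powers denote iteration, negative powers inverse. For a $2n\times 2n$ array $P=\begin{pmatrix}P_{11}&P_{12}\\P_{21}&P_{22}\end{pmatrix}$ with $n\times n$ blocks, $\pi_{D,2}(P)=\begin{pmatrix}\pi_{D,1}(P_{11})&P_{12}\\P_{21}&\pi_{D,1}^{-1}(P_{22})\end{pmatrix}$ and $\pi_{AD,2}(P)=\begin{pmatrix}P_{11}&\pi_{AD,1}(P_{12})\\ \pi_{AD,1}^{-1}(P_{21})&P_{22}\end{pmatrix}$. Lifting of $I_g$: for $\mathcal{P}=\{P_0,\dots,P_{g-1}\}$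 and $P_\ast$ all of the same size, $L_{\mathcal{P},P_\ast}(I_g)$ is the $g\times g$ block array whose $i$-th diagonal block is $P_i$ and whose off-diagonal blocks are copies of $P_\ast$ with integers relabelled so that the integer sets of these copies are disjoint from each other and from the integers of $P_0,\dots,P_{g-1}$. *)

(* Defs.v *)
From mathcomp Require Import all_boot all_order all_algebra finmap.

Set Implicit Arguments.
Unset Strict Implicit.
Unset Printing Implicit Defensive.

Local Open Scope nat_scope.

(* [Some s] is the integer entry s, [None] is the entry "*". *)
Notation array f K := 'M[option int]_(f, K).

Definition integers_of f K (P : array f K) : pred int :=
  [pred s | [exists c : 'I_f * 'I_K, P c.1 c.2 == Some s]].

(* The size is asserted by equalities (rather than read off the type) because
   block arrays have sizes such as \sum_(i < g) n. *)
Record is_PDA (K f Z : nat) (S : {fset int}) m n (P : array m n) : Prop := {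
  pda_rows : m = f;
  pda_cols : n = K;
  pda_rows_gt0 : 0 < f;
  pda_cols_gt0 : 0 < K;
  pda_entries : forall j k s, P j k = Some s -> s \in S;
  pda_stars : forall k, #|[set j | P j k == None]| = Z;
  pda_occurs : forall s, s \in S -> exists j k, P j k = Some s;
  pda_Blackburn : forall j1 k1 j2 k2 s, (j1, k1) != (j2, k2) ->
    P j1 k1 = Some s -> P j2 k2 = Some s ->
    P j1 k2 = None /\ P j2 k1 = None
}.

Definition is_regular_PDA (g K f Z : nat) (S : {fset int})
    m n (P : array m n) : Prop :=
  is_PDA K f Z S P /\
  forall s, s \in S -> #|[set c : 'I_m * 'I_n | P c.1 c.2 == Some s]| = g.

Definition is_gPDA (g : nat) f K (P : array f K) : Prop :=
  exists Z S, is_regular_PDA g K f Z S P.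

Definition is_regular_PDA_num (g K f Z N : nat) m n (P : array m n) : Prop :=
  exists2 S : {fset int}, #|` S|%fset = N & is_regular_PDA g K f Z S P.

Definition Blackburn_compatible f K (P0 P1 Pstar : array f K) : Prop :=
  forall i1 j1 i2 j2 s, P0 i1 j1 = Some s -> P1 i2 j2 = Some s ->
    Pstar i1 j2 = None /\ Pstar i2 j1 = None.

Definition Blackburn_compatible_family (I : Type) f K
    (Ps : I -> array f K) (Pstar : array f K) : Prop :=
  forall k l, Ps k != Ps l -> Blackburn_compatible (Ps k) (Ps l) Pstar.

Definition diag_array n (t : int) : array n n :=
  \matrix_(i, j) if i == j then Some t else None.

Definition antidiag_array n (t : int) : array n n :=
  \matrix_(i, j) if j == rev_ord i then Some t else None.

Definition int_range (m : nat) : seq int := [seq Posz k | k <- iota 0 m].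

Local Notation "s `_ i" := (nth (Posz 0) s i).

(* In the next three arrays the duplicate-free sequence s lists the set of
   integers in the order in which they are used; the index of an entry is the
   number of filled cells that precede it in row-major order. *)
Definition J_array n (s : seq int) : array n n :=
  \matrix_(i, j) Some s`_(i * n + j).

Definition H_array n (s : seq int) : array n n :=
  let below (i j : 'I_n) := Some s`_(\sum_(0 <= r < i) r + j) in
  \matrix_(i, j)
    if i == j then None else if j < i then below i j else below j i.

Definition G_array n (s : seq int) : array n n :=
  let above (i j : 'I_n) := Some s`_(\sum_(0 <= r < i) (n.-1 - r) + j) in
  \matrix_(i, j)
    if j == rev_ord i then None
    else if i + j < n.-1 then above i j
    else above (rev_ord j) (rev_ord i).

Definition piD1 n (P : array n n) : array n n :=
  \matrix_(i, j) if i == j then P (ord_pred i) (ord_pred j) else P i j.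

Definition piD1_inv n (P : array n n) : array n n :=
  \matrix_(i, j) if i == j then P (ordS i) (ordS j) else P i j.

Definition piAD1 n (P : array n n) : array n n :=
  \matrix_(i, j) if j == rev_ord i then P (ordS i) (ord_pred j) else P i j.

Definition piAD1_inv n (P : array n n) : array n n :=
  \matrix_(i, j) if j == rev_ord i then P (ord_pred i) (ordS j) else P i j.

Definition piD2 n (P : array (n + n) (n + n)) : array (n + n) (n + n) :=
  block_mx (piD1 (ulsubmx P)) (ursubmx P)
           (dlsubmx P) (piD1_inv (drsubmx P)).

Definition piAD2 n (P : array (n + n) (n + n)) : array (n + n) (n + n) :=
  block_mx (ulsubmx P) (piAD1 (ursubmx P))
           (piAD1_inv (dlsubmx P)) (drsubmx P).

Definition powers g n (pi : array n n -> array n n) (P : array n n) :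
  'I_g -> array n n := fun k => iter k pi P.
Arguments powers : clear implicits.
Arguments powers g {n} pi P _.

Definition is_relabelling g m n (Ps : 'I_g -> array m n) (Pstar : array m n)
    (rho : 'I_g -> 'I_g -> int -> int) : Prop :=
  [/\ forall i j, i != j -> {in integers_of Pstar &, injective (rho i j)},
      forall i j i' j', i != j -> i' != j' -> (i, j) != (i', j') ->
        {in integers_of Pstar &, forall x y, rho i j x != rho i' j' y}
    & forall i j k, i != j ->
        {in integers_of Pstar, forall x, rho i j x \notin integers_of (Ps k)}].

Definition lift_with g m n (Ps : 'I_g -> array m n) (Pstar : array m n)
    (rho : 'I_g -> 'I_g -> int -> int) :
    array (\sum_(i < g) m) (\sum_(j < g) n) :=
  \mxblock_(i < g, j < g)
    if i == j then Ps i else map_mx (omap (rho i j)) Pstar.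

(* The lifting of I_g is determined only up to the choice of relabelling. *)
Definition is_lifting_of_I g m n (Ps : 'I_g -> array m n) (Pstar : array m n)
    (L : array (\sum_(i < g) m) (\sum_(j < g) n)) : Prop :=
  exists2 rho, is_relabelling Ps Pstar rho & L = lift_with Ps Pstar rho.

Lemma piD1K n : cancel (@piD1 n) (@piD1_inv n).
Proof.
move=> P; apply/matrixP=> i j; rewrite !mxE.
by case: eqP => [->|//]; rewrite eqxx !ordSK.
Qed.

Lemma rev_ordS n (i : 'I_n) : rev_ord (ordS i) = ord_pred (rev_ord i).
Proof.
apply: val_inj => /=; case: n i => [[]//|n] i.
have := ltn_ord i; rewrite leq_eqVlt => /orP[/eqP[e]|lt_in].
  by rewrite e modnn subSS subn0 subnn add0n modn_small.
rewrite modn_small // [RHS](_ : _ = (n - i.+1 + n.+1) %% n.+1).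
  by rewrite modnDr modn_small ?subSS // ltnS leq_subr.
by rewrite subSS subnS -[in LHS](prednK (n := n - i)) ?subn_gt0.
Qed.

Lemma rev_ord_pred n (i : 'I_n) : rev_ord (ord_pred i) = ordS (rev_ord i).
Proof. by rewrite -[in RHS](ord_predK i) rev_ordS ord_predK. Qed.

Lemma piAD1K n : cancel (@piAD1 n) (@piAD1_inv n).
Proof.
move=> P; apply/matrixP=> i j; rewrite !mxE.
by case: eqP => [->|//]; rewrite rev_ord_pred eqxx ord_predK ordSK.
Qed.

Lemma lifting_exists g m n (Ps : 'I_g -> array m n) (Pstar : array m n) :
  exists L, is_lifting_of_I Ps Pstar L.
Proof.
pose B := (\max_(k < g) \max_(c : 'I_m * 'I_n)
             absz (odflt (Posz 0) (Ps k c.1 c.2))).+1.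
pose rho (i j : 'I_g) (x : int) := Posz (B + choice.pickle ((i, j), x)).
have rho_inj i j x i' j' y :
    rho i j x = rho i' j' y -> (i, j) = (i', j') /\ x = y.
  move=> [] /addnI e.
  by have [-> -> ->] := pcan_inj choice.pickleK e.
exists (lift_with Ps Pstar rho); exists rho => //; split.
- by move=> i j _ x y _ _ /rho_inj[].
- by move=> i j i' j' _ _ ne x y _ _; apply: contraNneq ne => /rho_inj[->].
- move=> i j k _ x _; apply/negP=> /existsP[c /eqP e].
  have: absz (rho i j x) < B.
    rewrite ltnS; apply: leq_trans (leq_bigmax k).
    by apply: leq_trans (leq_bigmax c); rewrite e.
  by rewrite ltnNge leq_addr.
Qed.

(* Main.v *)
(* All the rotations have one shape: reindexing an array P by the map that sends
   the cells (i, delta i) to (f i, delta (f i)) and fixes the others. The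
   non-star cells of J, G and H carrying the same integer form the orbits of an
   involution tau on cells (the identity for J, the reflection in the star
   (anti-)diagonal for G and H) that commutes with this map, so every power of
   the rotation is again such an array, over the same integers. If two different
   powers agree at two cells of the rotated (anti-)diagonal, these lie in
   different positions of it, hence their corners are off it; elsewhere the two
   powers coincide with P, and the cells are equal or exchanged by tau.
   In a lifting, integers of the diagonal blocks are handled by compatibility
   and those of the other blocks by the disjointness of the relabellings. The
   number of integers of a g-regular (K, f, Z) PDA then follows by counting its
   non-star cells: |S| g = K (f - Z). *)

Require Import Defs.
From mathcomp Require Import all_boot all_order all_algebra finmap.
From mathcomp Require Import zify.
Set Implicit Arguments.
Unset Strict Implicit.
Unset Printing Implicit Defensive.

Local Open Scope nat_scope.

(** * Counting the entries of an array *)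

Definition occurrences m n (P : array m n) (s : int) : nat :=
  #|[set c : 'I_m * 'I_n | P c.1 c.2 == Some s]|.

Lemma integers_ofP m n (P : array m n) s :
  reflect (exists j k, P j k = Some s) (s \in integers_of P).
Proof.
apply: (iffP existsP) => [[[j k] /eqP e]|[j [k e]]]; first by exists j, k.
by exists (j, k); apply/eqP.
Qed.

(** The canonical choice of the integer set of an array, so that liftings and rotations need no
    integer set of their own. *)
Definition entries m n (P : array m n) : {fset int} :=
  seq_fset tt (pmap (fun c => P c.1 c.2) (enum {: 'I_m * 'I_n})).

Lemma mem_entries m n (P : array m n) s :
  (s \in entries P) = (s \in integers_of P).
Proof.
rewrite seq_fsetE mem_pmap; apply/mapP/integers_ofP.
  by move=> [[j k] _ /= e]; exists j, k.
by move=> [j [k e]]; exists (j, k); rewrite ?mem_enum //= e.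
Qed.

Lemma occurrencesE m n (P : array m n) s :
  occurrences P s = \sum_j \sum_k (P j k == Some s).
Proof.
rewrite /occurrences -sum1dep_card big_mkcond /=.
rewrite (pair_big xpredT xpredT (fun j k => nat_of_bool (P j k == Some s))) /=.
by apply: eq_bigr => c _; case: eqP.
Qed.

Lemma column_starsE m n (P : array m n) k :
  #|[set j | P j k == None]| = \sum_j (P j k == None).
Proof.
by rewrite -sum1dep_card big_mkcond; apply: eq_bigr => j _; case: eqP.
Qed.

(** For this integer set, membership of the entries and (C2) are automatic; what remains is the star
    count, the Blackburn property and regularity. *)
Lemma regular_PDA_entries h Z m n (P : array m n) : 0 < m -> 0 < n ->
    (forall k, #|[set j | P j k == None]| = Z) ->
    (forall j1 k1 j2 k2 s, (j1, k1) != (j2, k2) ->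
      P j1 k1 = Some s -> P j2 k2 = Some s ->
      P j1 k2 = None /\ P j2 k1 = None) ->
    {in integers_of P, forall s, occurrences P s = h} ->
  is_regular_PDA h n m Z (entries P) P.
Proof.
move=> m0 n0 hZ hB ho; split; last first.
  by move=> s; rewrite mem_entries => /ho.
split=> //.
  by move=> j k s e; rewrite mem_entries; apply/integers_ofP; exists j, k.
by move=> s; rewrite mem_entries => /integers_ofP.
Qed.

(** Double counting of the non-star cells: [f - Z] in each of [K] columns, and [h] for each
    integer. *)
Lemma regular_PDA_card h K f Z S m n (P : array m n) :
  is_regular_PDA h K f Z S P -> #|` S|%fset * h = K * (f - Z).
Proof.
case=> [[em en _ _ hS hZ _ _] hr]; subst f K.
have -> : n * (m - Z) = \sum_(k < n) \sum_(j < m) (P j k != None).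
  rewrite -[n in LHS]card_ord -sum_nat_const; apply: eq_bigr => k _.
  have := cardsC [set j | P j k == None]; rewrite hZ card_ord => em.
  rewrite -[in LHS]em addKn.
  rewrite -sum1_card big_mkcond; apply: eq_bigr => j _.
  by rewrite !inE; case: eqP.
rewrite cardfE -sum_nat_const.
rewrite exchange_big /= pair_big /=.
transitivity (\sum_(s : S) \sum_(c : 'I_m * 'I_n) (P c.1 c.2 == Some (val s))).
  apply: eq_bigr => s _; rewrite -(hr _ (valP s)) -/(occurrences P (val s)).
  by rewrite occurrencesE pair_big.
rewrite exchange_big /=; apply: eq_bigr => -[j k] _ /=.
case e: (P j k) => [s|] /=; last by rewrite big1.
(* A non-star cell is counted for exactly one integer of [S], its own entry. *)
rewrite (bigD1 [` hS _ _ _ e]%fset) //= eqxx big1 ?addn0 // => s' ne.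
by apply/eqP; rewrite eqb0; apply: contraNneq ne => -[es]; apply/eqP/val_inj.
Qed.

(** * Liftings *)

Section Lifting.

Variables (g m n : nat).

(** Turns an index of the block array into a block number and a position inside the block; all
    arguments on liftings run on such pairs. *)
Definition block_index p (r : 'I_(\sum_(i < g) p)) : 'I_g * 'I_p :=
  (tagnat.sig1 r, tagnat.sig2 r).

Lemma block_index_bij p : bijective (@block_index p).
Proof.
exists (fun c => @tagnat.Rank g (fun=> p) c.1 c.2) => [r|[i a]].
  by rewrite /block_index /= tagnat.sig2K.
rewrite /block_index /= tagnat.Rank1K; congr (_, _).
by rewrite tagnat.Rank2K; apply: val_inj.
Qed.

Lemma sum_block_index p (F : 'I_g -> 'I_p -> nat) :
  \sum_r F (block_index r).1 (block_index r).2 = \sum_i \sum_a F i a.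
Proof.
rewrite pair_big /= [RHS](reindex (@block_index p)) //.
by have [q qK Kq] := block_index_bij p; exists q => c _.
Qed.

Variables (Ps : 'I_g -> array m n) (Pstar : array m n).
Variable rho : 'I_g -> 'I_g -> int -> int.

Definition lift_block (i j : 'I_g) : array m n :=
  if i == j then Ps i else map_mx (omap (rho i j)) Pstar.

Lemma lift_withE r c : lift_with Ps Pstar rho r c =
  lift_block (block_index r).1 (block_index c).1
    (block_index r).2 (block_index c).2.
Proof. by rewrite mxE /lift_block /=; case: eqP. Qed.

Hypothesis rho_relabels : is_relabelling Ps Pstar rho.

Lemma lift_block_offdiag i j a b s : i != j -> lift_block i j a b = Some s ->
  exists2 x, Pstar a b = Some x & s = rho i j x.
Proof.
rewrite /lift_block => /negPf->; rewrite mxE.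
by case e: (Pstar a b) => [x|] //= [<-]; exists x.
Qed.

(** Equal integers lie either both in diagonal blocks or both in the same off-diagonal block:
    relabelled integers are new, and distinct copies of [Pstar] are disjoint. *)
Lemma lift_block_Blackburn :
    (forall k j1 k1 j2 k2 s, (j1, k1) != (j2, k2) ->
      Ps k j1 k1 = Some s -> Ps k j2 k2 = Some s ->
      Ps k j1 k2 = None /\ Ps k j2 k1 = None) ->
    (forall j1 k1 j2 k2 s, (j1, k1) != (j2, k2) ->
      Pstar j1 k1 = Some s -> Pstar j2 k2 = Some s ->
      Pstar j1 k2 = None /\ Pstar j2 k1 = None) ->
    (forall k l, k != l -> Blackburn_compatible (Ps k) (Ps l) Pstar) ->
  forall i1 a1 j1 b1 i2 a2 j2 b2 s, ((i1, a1), (j1, b1)) != ((i2, a2), (j2, b2)) ->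
    lift_block i1 j1 a1 b1 = Some s -> lift_block i2 j2 a2 b2 = Some s ->
    lift_block i1 j2 a1 b2 = None /\ lift_block i2 j1 a2 b1 = None.
Proof.
have [rho_inj rho_disj rho_new] := rho_relabels.
move=> PsB PstarB compat i1 a1 j1 b1 i2 a2 j2 b2 s ne.
have [e1|n1] := eqVneq i1 j1; have [e2|n2] := eqVneq i2 j2.
- subst j1 j2; rewrite /lift_block !eqxx => h1 h2.
  have [e|n12] := eqVneq i1 i2.
    subst i2; apply: PsB h1 h2.
    by apply: contraNneq ne => -[-> ->].
  (* The corners lie in the blocks [(i1, i2)] and [(i2, i1)], which are copies of [Pstar], so
     compatibility makes them stars. *)
  by have [] := compat _ _ n12 _ _ _ _ _ h1 h2; rewrite !mxE => -> ->.
- subst j1; rewrite {1}/lift_block eqxx => h1 /(lift_block_offdiag n2)[x hx es].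
  have xin : x \in integers_of Pstar by apply/integers_ofP; exists a2, b2.
  case/negP: (rho_new _ _ i1 n2 _ xin); rewrite -es.
  by apply/integers_ofP; exists a1, b1.
- subst j2 => /(lift_block_offdiag n1)[x hx es]; rewrite {1}/lift_block eqxx => h2.
  have xin : x \in integers_of Pstar by apply/integers_ofP; exists a1, b1.
  case/negP: (rho_new _ _ i2 n1 _ xin); rewrite -es.
  by apply/integers_ofP; exists a2, b2.
- move=> /(lift_block_offdiag n1)[x hx es] /(lift_block_offdiag n2)[y hy es'].
  have xin : x \in integers_of Pstar by apply/integers_ofP; exists a1, b1.
  have yin : y \in integers_of Pstar by apply/integers_ofP; exists a2, b2.
  have [[ei ej]|nij] := eqVneq (i1, j1) (i2, j2); last first.
    by have := rho_disj _ _ _ _ n1 n2 nij _ _ xin yin; rewrite -es -es' eqxx.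
  subst i2 j2; rewrite /lift_block (negPf n1) !mxE.
  have exy : x = y by apply: (rho_inj _ _ n1) => //; rewrite -es.
  subst y; have [|-> ->] // := PstarB _ _ _ _ _ _ hx hy.
  by apply: contraNneq ne => -[-> ->].
Qed.

(** Off-diagonal blocks avoid the integers of all [Ps k], so only the [g] diagonal blocks
    contribute, [h] each. *)
Lemma lift_block_occurrences_diag h s k : s \in integers_of (Ps k) ->
    (forall i, occurrences (Ps i) s = h) ->
  \sum_i \sum_j occurrences (lift_block i j) s = h * g.
Proof.
have [rho_inj rho_disj rho_new] := rho_relabels.
move=> sk hk; rewrite mulnC -[g in RHS]card_ord -sum_nat_const.
apply: eq_bigr => i _; rewrite (bigD1 i) //= {1}/lift_block eqxx hk.
rewrite big1 ?addn0 // => j ne; rewrite eq_sym in ne.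
apply/eqP; rewrite cards_eq0; apply/eqP/setP => -[a b]; rewrite !inE /=.
apply/negP => /eqP /(lift_block_offdiag ne)[x hx es].
have xin : x \in integers_of Pstar by apply/integers_ofP; exists a, b.
by have := rho_new _ _ k ne _ xin; rewrite -es sk.
Qed.

(** A relabelled integer meets no diagonal block and no other copy of [Pstar], and [rho i j] merges
    no two integers of its own copy. *)
Lemma lift_block_occurrences_offdiag i j x : i != j -> x \in integers_of Pstar ->
  \sum_i' \sum_j' occurrences (lift_block i' j') (rho i j x) = occurrences Pstar x.
Proof.
have [rho_inj rho_disj rho_new] := rho_relabels.
move=> ne xin; rewrite pair_big /= (bigD1 (i, j)) //= big1 ?addn0.
  apply: eq_card => -[a b]; rewrite !inE /= /lift_block (negPf ne) mxE.
  case e: (Pstar a b) => [y|] //=; apply/eqP/eqP => [[]|[-> //]].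
  by move/(rho_inj _ _ ne) => -> //; apply/integers_ofP; exists a, b.
move=> [i' j'] /= ne'; apply/eqP; rewrite cards_eq0; apply/eqP/setP => -[a b].
rewrite !inE /=; apply/negP => /eqP.
have [e|nij] := eqVneq i' j'.
  subst j'; rewrite /lift_block eqxx => e.
  case/negP: (rho_new _ _ i' ne _ xin).
  by apply/integers_ofP; exists a, b.
move/(lift_block_offdiag nij) => [y hy es].
have yin : y \in integers_of Pstar by apply/integers_ofP; exists a, b.
by have := rho_disj _ _ _ _ nij ne ne' _ _ yin xin; rewrite -es eqxx.
Qed.

End Lifting.

(** The arrays [Ps k] share one integer set [S], so an integer of a diagonal block occurs [h] times
    in each of them. This gives [h * g], the regularity asked of [Pstar]. *)
Lemma lifting_regular_PDA g m n h Z Zs (S Ss : {fset int})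
    (Ps : 'I_g -> array m n) (Pstar : array m n) L : 0 < g ->
    (forall k, is_regular_PDA h n m Z S (Ps k)) ->
    is_regular_PDA (h * g) n m Zs Ss Pstar ->
    (forall k l, k != l -> Blackburn_compatible (Ps k) (Ps l) Pstar) ->
    is_lifting_of_I Ps Pstar L ->
  is_regular_PDA (h * g) (g * n) (g * m) (Z + (g - 1) * Zs) (entries L) L.
Proof.
move=> g0 hPs hPstar compat [rho hrho eL].
have em p : \sum_(i < g) p = g * p by rewrite sum_nat_const card_ord.
have [[[_ _ m0 n0 _ _ _ _] _] [[_ _ _ _ SsE Zstar _ PstarB] occstar]] :=
  (hPs (Ordinal g0), hPstar).
have LE r c : L r c = lift_block Ps Pstar rho (block_index r).1 (block_index c).1
    (block_index r).2 (block_index c).2 by rewrite eL lift_withE.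
rewrite -!em; apply: regular_PDA_entries; rewrite ?em ?muln_gt0 ?g0 //.
- move=> c; rewrite column_starsE; under eq_bigr do rewrite LE.
  rewrite (sum_block_index (fun i a => nat_of_bool (lift_block Ps Pstar rho i
     (block_index c).1 a (block_index c).2 == None))).
  (* A block column has one diagonal block, with [Z] stars per column, and [g - 1] copies of
     [Pstar], with [Zs] each. *)
  rewrite (bigD1 (block_index c).1) //=; congr (_ + _).
    rewrite -column_starsE /lift_block eqxx.
    by have [[_ _ _ _ _ -> _ _] _] := hPs (block_index c).1.
  rewrite (eq_bigr (fun=> Zs)) => [|i ne].
    by rewrite sum_nat_const cardC1 card_ord subn1.
  rewrite /lift_block (negPf ne) -(Zstar (block_index c).2) column_starsE.
  by apply: eq_bigr => a _; rewrite mxE; case: (Pstar _ _).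
- move=> r1 c1 r2 c2 s ne; rewrite !LE; apply: lift_block_Blackburn => //.
  + by move=> k; have [[]] := hPs k.
  + have bi p := bij_inj (@block_index_bij g p).
    apply: contraNneq ne; rewrite -!surjective_pairing => e.
    by rewrite (bi _ _ _ (congr1 fst e)) (bi _ _ _ (congr1 snd e)).
- move=> s /integers_ofP[r [c]]; rewrite LE => hs; rewrite occurrencesE.
  under eq_bigr do under eq_bigr do rewrite LE.
  rewrite (sum_block_index (fun i a => \sum_k nat_of_bool (lift_block Ps Pstar rho i
     (block_index k).1 a (block_index k).2 == Some s))).
  under eq_bigr => i _ do under eq_bigr => a _ do rewrite
    (sum_block_index (fun j b => nat_of_bool (lift_block Ps Pstar rho i j a b == Some s))).
  rewrite (eq_bigr (fun i => \sum_j occurrences (lift_block Ps Pstar rho i j) s)); last first.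
    by move=> i _; rewrite exchange_big /=; apply: eq_bigr => j _; rewrite occurrencesE.
  have [e|ne] := eqVneq (block_index r).1 (block_index c).1.
    move: hs; rewrite {1}/lift_block e eqxx => hs.
    have sin : s \in integers_of (Ps (block_index c).1).
      by apply/integers_ofP; do 2!eexists; exact: hs.
    apply: lift_block_occurrences_diag sin _ => // i.
    have [[_ _ _ _ SE _ _ _] _] := hPs (block_index c).1.
    by have [_ ho] := hPs i; apply: ho; apply: SE hs.
  have [x hx ->] := lift_block_offdiag ne hs.
  rewrite lift_block_occurrences_offdiag //; first exact/occstar/(SsE _ _ _ hx).
  by apply/integers_ofP; do 2!eexists; exact: hx.
Qed.

(** * Rotations along the diagonal or the anti-diagonal *)

Definition entry n (P : array n n) (c : 'I_n * 'I_n) : option int := P c.1 c.2.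

(** The cells holding a given integer form one orbit of [tau], of size [h]. The last field is the
    Blackburn property for a cell and its twin. *)
Record twin_array n (h Z : nat) (tau : 'I_n * 'I_n -> 'I_n * 'I_n)
    (P : array n n) : Prop := {
  twin_stars : forall k, #|[set j | P j k == None]| = Z;
  twin_entry : forall c, entry P (tau c) = entry P c;
  twin_inj : forall c d s, entry P c = Some s -> entry P d = Some s ->
    d = c \/ d = tau c;
  twin_card : forall c, entry P c != None -> #|[set c; tau c]| = h;
  twin_corner : forall c, entry P c != None -> tau c != c ->
    P c.1 (tau c).2 = None /\ P (tau c).1 c.2 = None
}.

Lemma twin_array_regular n h Z tau (P : array n n) : 0 < n ->
  twin_array h Z tau P -> is_regular_PDA h n n Z (entries P) P.
Proof.
move=> n0 [Pstars Ptau Pinj Pcard Pcorner]; apply: regular_PDA_entries => //.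
- move=> j1 k1 j2 k2 s ne h1 h2.
  have c1 : entry P (j1, k1) != None by rewrite /entry h1.
  rewrite eq_sym in ne.
  have [e|e] := Pinj (j1, k1) (j2, k2) s h1 h2; first by rewrite e eqxx in ne.
  by have := Pcorner _ c1; rewrite -e => /(_ ne).
- move=> s /integers_ofP[j [k e]].
  rewrite -(Pcard (j, k)) /entry ?e //; apply: eq_card => c; rewrite !inE.
  apply/eqP/orP => [ec|[/eqP->|/eqP->] //]; last by rewrite -/(entry P _) Ptau.
  by have [->|->] := Pinj (j, k) c s e ec; [left|right].
Qed.

(* With delta the identity or rev_ord, the cells (i, delta i) form the diagonal
   or the anti-diagonal, and rotating moves the entries along them. *)
Definition rotate_cell n (delta f : 'I_n -> 'I_n) (c : 'I_n * 'I_n) :=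
  if c.2 == delta c.1 then (f c.1, delta (f c.1)) else c.

(** A pull-back: position [i] of the line receives the entry from position [f i]. Shifting entries
    down the diagonal therefore means [f] is [ord_pred]. *)
Definition rotate n (delta f : 'I_n -> 'I_n) (P : array n n) : array n n :=
  \matrix_(i, j) entry P (rotate_cell delta f (i, j)).

Lemma entry_rotate n (delta f : 'I_n -> 'I_n) P c :
  entry (rotate delta f P) c = entry P (rotate_cell delta f c).
Proof. by rewrite /entry mxE -surjective_pairing. Qed.

(** A cell of the line stays on the line, so iterating the rotation only iterates [f]. *)
Lemma iter_rotate n (delta f : 'I_n -> 'I_n) P k :
  iter k (rotate delta f) P = rotate delta (iter k f) P.
Proof.
elim: k => [|k IHk]; apply/matrixP => i j; rewrite -!/(entry _ (i, j)).
  by rewrite entry_rotate /rotate_cell /=; case: eqP => // <-.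
rewrite iterS IHk !entry_rotate; congr (entry P _).
rewrite [rotate_cell _ f _]/rotate_cell [RHS]/rotate_cell /=.
case: ifP => [/eqP ej|nj]; rewrite /rotate_cell /= ?eqxx ?nj //.
by rewrite -iterSr.
Qed.

Lemma rotate_cell_inj n (delta f : 'I_n -> 'I_n) :
  injective f -> injective (rotate_cell delta f).
Proof.
move=> f_inj [i j] [k l]; rewrite /rotate_cell /=.
case: eqP => [->|nj]; case: eqP => [->|nl] // e.
- by case: e => /f_inj->.
- by case: e nl => <- <-.
- by case: e nj => -> ->.
Qed.

(** An injective [f] makes [rotate_cell] a permutation of the finite set of cells. *)
Lemma entries_rotate n (delta f : 'I_n -> 'I_n) P : injective f ->
  entries (rotate delta f P) = entries P.
Proof.
move=> f_inj; have [q qK Kq] := injF_bij (@rotate_cell_inj _ delta _ f_inj).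
apply/fsetP => s; rewrite !mem_entries; apply/integers_ofP/integers_ofP.
  by move=> [i [j]]; rewrite mxE => e; do 2!eexists; exact: e.
move=> [i [j e]]; exists (q (i, j)).1, (q (i, j)).2.
by rewrite mxE -surjective_pairing Kq.
Qed.

(** Covers [diag_array] and [antidiag_array] at once: [t] fills the graph of a permutation, and row
    [q k] holds the only [t] of column [k]. *)
Lemma star_permutation_regular n (delta : 'I_n -> 'I_n) t (Pstar : array n n) :
    0 < n -> injective delta ->
    (forall i j, Pstar i j = if j == delta i then Some t else None) ->
  is_regular_PDA n n n (n - 1) (entries Pstar) Pstar.
Proof.
move=> n0 dinj PE; have [q qK Kq] := injF_bij dinj.
apply: regular_PDA_entries => //.
- move=> k; rewrite -[in RHS](card_ord n) subn1 -(cardsC1 (q k)).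
  apply: eq_card => i; rewrite !inE PE; apply/idP/idP.
    by apply: contraL => /eqP ->; rewrite Kq eqxx.
  by apply: contraNT; have [->|//] := eqVneq k (delta i); rewrite qK eqxx.
- move=> j1 k1 j2 k2 s ne; rewrite !PE.
  case: eqP => // e1 _; case: eqP => // e2 _; subst k1 k2.
  have nj : j1 != j2 by apply: contraNneq ne => ->.
  by rewrite !(inj_eq dinj) (negPf nj) eq_sym (negPf nj).
- move=> s /integers_ofP[i [j]]; rewrite PE; case: eqP => // _ [<-].
  rewrite -[RHS](card_ord n) -(card_imset predT (f := fun i => (i, delta i))).
    apply: eq_card => -[i' j']; rewrite !inE PE /=.
    apply/idP/imsetP => [|[x _ [-> ->]]]; last by rewrite !eqxx.
    by have [-> _|//] := eqVneq j' (delta i'); exists i'.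
  by move=> x y [].
Qed.

(** * Rotations of a twin array along a star-free line *)

Section RotatedTwins.

Variables (n h Z : nat) (tau : 'I_n * 'I_n -> 'I_n * 'I_n).
Variables (delta eps : 'I_n -> 'I_n) (P : array n n).
Hypothesis P_twin : twin_array h Z tau P.
Hypothesis tauK : involutive tau.
Hypothesis delta_inj : injective delta.
(** [eps] is the action of [tau] on the positions of the line: the identity for J, [rev_ord] for G
    and H. *)
Hypothesis tau_delta : forall i, tau (i, delta i) = (eps i, delta (eps i)).
Hypothesis P_delta : forall i, P i (delta i) != None.

(** [tau] maps the line into itself; as an involution it also preserves the complement. *)
Lemma tau_off_delta c : ((tau c).2 == delta (tau c).1) = (c.2 == delta c.1).
Proof.
apply/eqP/eqP => e; last by rewrite [c]surjective_pairing e tau_delta.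
by rewrite -[c]tauK [tau c]surjective_pairing e tau_delta.
Qed.

Lemma rotate_cell_delta f c :
  ((rotate_cell delta f c).2 == delta (rotate_cell delta f c).1) =
  (c.2 == delta c.1).
Proof. by rewrite {1 2}/rotate_cell; case: ifP => [|->] /=; rewrite ?eqxx. Qed.

Lemma rotate_cell_tau f c : {morph f : i / eps i} ->
  rotate_cell delta f (tau c) = tau (rotate_cell delta f c).
Proof.
move=> f_eps; rewrite /rotate_cell tau_off_delta.
case: ifP => // /eqP e; rewrite [c]surjective_pairing e !tau_delta /=.
by rewrite f_eps.
Qed.

(** Only cells of the line change their entry, and the line holds no star before or after. *)
Lemma rotate_star f i j : (rotate delta f P i j == None) = (P i j == None).
Proof.
rewrite mxE /entry /rotate_cell /=; have [->|//] := eqVneq j (delta i).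
by rewrite !(negPf (P_delta _)).
Qed.

Lemma rotate_twin f : injective f -> {morph f : i / eps i} ->
  twin_array h Z tau (rotate delta f P).
Proof.
have [Pstars Ptau Pinj Pcard Pcorner] := P_twin.
move=> f_inj f_eps; split.
- move=> k; rewrite -(Pstars k); apply: eq_card => j.
  by rewrite !inE rotate_star.
- by move=> c; rewrite !entry_rotate rotate_cell_tau.
- move=> c d s; rewrite !entry_rotate => hc hd.
  have [/(rotate_cell_inj f_inj)|] := Pinj _ _ _ hc hd; first by left.
  by rewrite -rotate_cell_tau // => /(rotate_cell_inj f_inj); right.
- by move=> c; rewrite /entry rotate_star; apply: Pcard.
- move=> c; rewrite /entry rotate_star => hc ne.
  have [/eqP h1 /eqP h2] := Pcorner _ hc ne.
  by split; apply/eqP; rewrite rotate_star.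
Qed.

(** The condition on [f1] and [f2] says that a position of the line never holds the same integer in
    both rotations. *)
Lemma rotate_compatible f1 f2 (Pstar : array n n) :
    {morph f2 : i / eps i} -> injective f2 ->
    (forall i, f2 i != f1 i /\ f2 i != eps (f1 i)) ->
    (forall i j, j != delta i -> Pstar i j = None) ->
  Blackburn_compatible (rotate delta f1 P) (rotate delta f2 P) Pstar.
Proof.
have [Pstars Ptau Pinj Pcard Pcorner] := P_twin.
move=> f2_eps f2_inj f12 PE i1 j1 i2 j2 s.
rewrite !mxE => h1 h2; have := Pinj _ _ _ h1 h2.
have [/eqP e1|ne1] := boolP (j1 == delta i1).
  subst j1; rewrite [rotate_cell _ f1 _]/rotate_cell /= eqxx tau_delta => e.
  have := rotate_cell_delta f2 (i2, j2); case: (boolP (j2 == _)) => /= [/eqP ej2 _|_].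
    subst j2; move: e; rewrite /rotate_cell /= eqxx.
    have [n1 n2] := f12 i1 => e.
    (* Two distinct positions of the line: since [delta] is injective, both corners are off it. *)
    have ne : i2 != i1.
      apply: contraTneq isT => e'; subst i2.
      by case: e => -[e _]; rewrite e eqxx in n1 n2.
    by split; apply: PE; rewrite (inj_eq delta_inj) // eq_sym.
  by case: e => -> /=; rewrite eqxx.
have eD : rotate_cell delta f1 (i1, j1) = (i1, j1) by rewrite /rotate_cell /= (negPf ne1).
rewrite eD => e.
have ne2 : j2 != delta i2.
  have := rotate_cell_delta f2 (i2, j2) => /= <-.
  by case: e => ->; rewrite ?tau_off_delta.
have eD2 : rotate_cell delta f2 (i2, j2) = (i2, j2) by rewrite /rotate_cell /= (negPf ne2).
rewrite eD2 in e; rewrite eD in h1.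
(* Off the line both rotations agree with [P]. For equal cells the corners are the cell itself; for
   twins they are stars of [P]. *)
have [e12|ne12] := eqVneq (i2, j2) (i1, j1).
  by case: e12 => -> ->; split; apply: PE.
case: e => e; first by rewrite e eqxx in ne12.
have h1' : entry P (i1, j1) != None by rewrite h1.
have := Pcorner _ h1'; rewrite -e => /(_ ne12) /= [k1 k2].
(* A star of [P] cannot lie on the star-free line. *)
by split; apply: PE; apply/eqP => ej; move: (P_delta i1) (P_delta i2);
  rewrite -?ej ?k1 ?k2 // => _; rewrite -?ej ?k1 ?k2.
Qed.

(** Gives distinctness of the powers: equal arrays would hold one integer at the line cell of row 0,
    forcing [f2] into the [eps]-orbit of [f1] there. *)
Lemma rotate_neq f1 f2 : 0 < n ->
    (forall i, f2 i != f1 i /\ f2 i != eps (f1 i)) ->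
  rotate delta f1 P != rotate delta f2 P.
Proof.
move=> n0 f12; apply/eqP => /matrixP/(_ (Ordinal n0)); set i := Ordinal n0.
move/(_ (delta i)); rewrite !mxE /rotate_cell /= eqxx => e.
case e1: (entry P (f1 i, delta (f1 i))) => [s|]; last first.
  by have := P_delta (f1 i); rewrite -/(entry P (_, _)) e1.
have [n1 n2] := f12 i; rewrite e1 in e.
have [] := twin_inj P_twin e1 (esym e); first by case=> e'; rewrite e' eqxx in n1.
by rewrite tau_delta => -[e']; rewrite e' eqxx in n2.
Qed.

Variables (g : nat) (f : 'I_n -> 'I_n) (t : int) (pi : array n n -> array n n).
Hypotheses (n_gt0 : 0 < n) (f_inj : injective f).
Hypothesis f_eps : {morph f : i / eps i}.
Hypothesis f_free : forall k l i, k < g -> l < g -> k != l ->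
  iter l f i != iter k f i /\ iter l f i != eps (iter k f i).
Hypothesis piE : pi =1 rotate delta f.
Variable Pstar : array n n.
Hypothesis PstarE :
  forall i j, Pstar i j = if j == delta i then Some t else None.

Let Ps := powers g pi P.

Lemma powers_rotate k : Ps k = rotate delta (iter k f) P.
Proof. by rewrite /Ps /powers (eq_iter piE) iter_rotate. Qed.

Lemma iter_f_inj k : injective (iter k f).
Proof. by elim: k => [|k IHk] // x y /= /f_inj/IHk. Qed.

Lemma iter_f_eps k : {morph iter k f : i / eps i}.
Proof. by move=> i; elim: k => [|k IHk] //=; rewrite IHk f_eps. Qed.

Lemma powers_regular k : is_regular_PDA h n n Z (entries P) (Ps k).
Proof.
rewrite powers_rotate -(entries_rotate delta P (@iter_f_inj k)).
apply: twin_array_regular => //; apply: rotate_twin; first exact: iter_f_inj.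
exact: iter_f_eps.
Qed.

Lemma powers_compatible k l : k != l ->
  Blackburn_compatible (Ps k) (Ps l) Pstar.
Proof.
move=> ne; rewrite !powers_rotate; apply: rotate_compatible.
- exact: iter_f_eps.
- exact: iter_f_inj.
- by move=> i; apply: f_free.
- by move=> i j /negPf nj; rewrite PstarE nj.
Qed.

Lemma powers_family :
  [/\ injective Ps, (forall k, is_gPDA h (Ps k))
    & Blackburn_compatible_family Ps Pstar].
Proof.
split.
- move=> k l; rewrite !powers_rotate; apply: contra_eq => ne.
  by apply: rotate_neq => // i; apply: f_free.
- by move=> k; exists Z, (entries P); apply: powers_regular.
- by move=> k l ne; apply: powers_compatible; apply: contraNneq ne => ->.
Qed.

(** [n = h * g] matches the [n] occurrences of [t] in [Pstar] with the regularity of the diagonal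
    blocks. *)
Lemma powers_lifting L : 0 < g -> n = h * g -> is_lifting_of_I Ps Pstar L ->
  is_regular_PDA n (g * n) (g * n) (Z + (g - 1) * (n - 1)) (entries L) L.
Proof.
move=> g0 nE hL; have starR := star_permutation_regular n_gt0 delta_inj PstarE.
have := lifting_regular_PDA (h := h) g0 powers_regular _ powers_compatible hL.
by rewrite -nE => /(_ _ _ starR).
Qed.

End RotatedTwins.

(** * The arrays J, G and H and their rotations *)

(** An arbitrary 1-PDA may have stars on the line, so the twin argument is replaced by uniqueness of
    the cell of each integer. *)
Lemma rotate_compatible_1PDA n (delta f : 'I_n -> 'I_n) (P Pstar : array n n) :
    is_gPDA 1 P -> injective delta -> (forall i, f i != i) ->
    (forall i j, j != delta i -> Pstar i j = None) ->
  Blackburn_compatible P (rotate delta f P) Pstar.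
Proof.
move=> [Z [S [[_ _ _ _ SE _ _ _] occ1]]] delta_inj f_ne PE i1 j1 i2 j2 s h1.
rewrite mxE => h2; have [c /setP cE] := cards1P (introT eqP (occ1 _ (SE _ _ _ h1))).
have /eqP e1 : (i1, j1) == c by have := cE (i1, j1); rewrite !inE h1 eqxx.
have := cE (rotate_cell delta f (i2, j2)).
rewrite !inE -/(entry P _) h2 eqxx -e1 /rotate_cell /= => /esym.
have [->|ne] := eqVneq j2 (delta i2) => /eqP[<- <-].
  by split; apply: PE; rewrite (inj_eq delta_inj) // eq_sym.
by split; apply: PE.
Qed.

(** * The four rotations as instances of [rotate] *)

Lemma piD1E n : @piD1 n =1 rotate id (@ord_pred n).
Proof.
move=> P; apply/matrixP => i j; rewrite !mxE /rotate_cell /= eq_sym.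
by have [->|] := eqVneq j i.
Qed.

Lemma piAD1E n : @piAD1 n =1 rotate (@rev_ord n) (@ordS n).
Proof.
move=> P; apply/matrixP => i j; rewrite !mxE /rotate_cell /=.
by have [->|] := eqVneq j (rev_ord i); rewrite // rev_ordS.
Qed.

(** Acts separately on the two halves of the indices, matching the two blocks that the line of a
    [2n] by [2n] array crosses. *)
Definition pair_shift n (p q : 'I_n -> 'I_n) (i : 'I_(n + n)) : 'I_(n + n) :=
  match split i with inl a => lshift n (p a) | inr a => rshift n (q a) end.

Lemma pair_shiftl n (p q : 'I_n -> 'I_n) a :
  pair_shift p q (lshift n a) = lshift n (p a).
Proof. by rewrite /pair_shift (unsplitK (inl _)). Qed.

Lemma pair_shiftr n (p q : 'I_n -> 'I_n) a :
  pair_shift p q (rshift n a) = rshift n (q a).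
Proof. by rewrite /pair_shift (unsplitK (inr _)). Qed.

Lemma rev_lshift n (a : 'I_n) : rev_ord (lshift n a) = rshift n (rev_ord a).
Proof. by apply: val_inj => /=; rewrite addnBA. Qed.

Lemma rev_rshift n (a : 'I_n) : rev_ord (rshift n a) = lshift n (rev_ord a).
Proof. by apply: val_inj => /=; rewrite -addnS subnDl. Qed.

Lemma piD2E n : @piD2 n =1 rotate id (pair_shift (@ord_pred n) (@ordS n)).
Proof.
move=> P; apply/matrixP => i j; rewrite [RHS]mxE /entry /rotate_cell /=.
case: (split_ordP i) => a ->; case: (split_ordP j) => b ->.
- rewrite block_mxEul !mxE pair_shiftl (inj_eq (@lshift_inj _ _)) eq_sym.
  by case: eqP => [->|].
- by rewrite block_mxEur !mxE eq_rlshift.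
- by rewrite block_mxEdl !mxE eq_lrshift.
- rewrite block_mxEdr !mxE pair_shiftr (inj_eq (@rshift_inj _ _)) eq_sym.
  by case: eqP => [->|].
Qed.

Lemma piAD2E n :
  @piAD2 n =1 rotate (@rev_ord _) (pair_shift (@ordS n) (@ord_pred n)).
Proof.
move=> P; apply/matrixP => i j; rewrite [RHS]mxE /entry /rotate_cell /=.
case: (split_ordP i) => a ->; case: (split_ordP j) => b ->.
- by rewrite block_mxEul !mxE rev_lshift eq_lrshift.
- rewrite block_mxEur !mxE pair_shiftl !rev_lshift (inj_eq (@rshift_inj _ _)).
  by have [->|] := eqVneq b _; rewrite //= rev_ordS.
- rewrite block_mxEdl !mxE pair_shiftr !rev_rshift (inj_eq (@lshift_inj _ _)).
  by have [->|] := eqVneq b _; rewrite //= rev_ord_pred.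
- by rewrite block_mxEdr !mxE rev_rshift eq_rlshift.
Qed.

(** * Freeness of the shifts and commutation with reversal *)

Lemma iter_ordS_free n k l (i : 'I_n) : k < n -> l < n -> k != l ->
  iter l (@ordS n) i != iter k (@ordS n) i.
Proof.
(* The iterates add their exponent modulo [n], and exponents below [n] are distinct residues. *)
have vE m : val (iter m (@ordS n) i) = (i + m) %% n.
  elim: m => [|m /= ->]; first by rewrite addn0 modn_small.
  by rewrite -addn1 modnDml addn1 addnS.
move=> kn ln; apply: contraNneq => /(congr1 val); rewrite !vE => /eqP.
by rewrite eqn_modDl !modn_small // eq_sym.
Qed.

Lemma iter_ord_pred_rev n k (i : 'I_n) :
  iter k (@ord_pred n) i = rev_ord (iter k (@ordS n) (rev_ord i)).
Proof.
by elim: k => [|k /= ->]; rewrite ?rev_ordK // rev_ordS.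
Qed.

Lemma iter_ord_pred_free n k l (i : 'I_n) : k < n -> l < n -> k != l ->
  iter l (@ord_pred n) i != iter k (@ord_pred n) i.
Proof.
by move=> kn ln kl; rewrite !iter_ord_pred_rev (inj_eq rev_ord_inj) iter_ordS_free.
Qed.

Lemma pair_shift_inj n (p q : 'I_n -> 'I_n) :
  injective p -> injective q -> injective (pair_shift p q).
Proof.
move=> p_inj q_inj i j; case: (split_ordP i) => a ->; case: (split_ordP j) => b ->.
- by rewrite !pair_shiftl => /lshift_inj/p_inj->.
- by rewrite pair_shiftl pair_shiftr => /eqP; rewrite eq_lrshift.
- by rewrite pair_shiftl pair_shiftr => /eqP; rewrite eq_rlshift.
- by rewrite !pair_shiftr => /rshift_inj/q_inj->.
Qed.

(** [rev_ord] exchanges the halves and conjugates [p] to [q]; this is why the second block rotates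
    in the inverse sense. *)
Lemma pair_shift_rev n (p q : 'I_n -> 'I_n) :
    (forall i, rev_ord (p i) = q (rev_ord i)) ->
  {morph pair_shift p q : i / rev_ord i}.
Proof.
move=> pq i; case: (split_ordP i) => a ->.
  by rewrite rev_lshift pair_shiftl pair_shiftr rev_lshift pq.
by rewrite rev_rshift pair_shiftl pair_shiftr rev_rshift -[in q _](rev_ordK a) -pq rev_ordK.
Qed.

(** Iterates stay in their half while [rev_ord] leaves it, so only freeness inside each half of size
    [n] is at stake. *)
Lemma iter_pair_shift_free n (p q : 'I_n -> 'I_n) :
    (forall k l i, k < n -> l < n -> k != l -> iter l p i != iter k p i) ->
    (forall k l i, k < n -> l < n -> k != l -> iter l q i != iter k q i) ->
  forall k l i, k < n -> l < n -> k != l ->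
    iter l (pair_shift p q) i != iter k (pair_shift p q) i /\
    iter l (pair_shift p q) i != rev_ord (iter k (pair_shift p q) i).
Proof.
move=> p_free q_free k l i kn ln kl.
have iterl m a : iter m (pair_shift p q) (lshift n a) = lshift n (iter m p a).
  by elim: m => //= m ->; rewrite pair_shiftl.
have iterr m a : iter m (pair_shift p q) (rshift n a) = rshift n (iter m q a).
  by elim: m => //= m ->; rewrite pair_shiftr.
case: (split_ordP i) => a ->.
  by rewrite !iterl rev_lshift eq_lrshift (inj_eq (@lshift_inj _ _)) p_free.
by rewrite !iterr rev_rshift eq_rlshift (inj_eq (@rshift_inj _ _)) q_free.
Qed.

(** * Row-major numbering when row [r] has [ell r] filled cells *)

Lemma row_index_lt (ell : nat -> nat) i i' j : i < i' -> j < ell i ->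
  \sum_(0 <= r < i) ell r + j < \sum_(0 <= r < i') ell r.
Proof.
move=> lt_ii' lt_j; rewrite [leqRHS](big_cat_nat (n := i.+1)) //= big_nat_recr //.
by apply: leq_trans (leq_addr _ _); rewrite ltn_add2l.
Qed.

Lemma row_index_inj (ell : nat -> nat) i i' j j' : j < ell i -> j' < ell i' ->
    \sum_(0 <= r < i) ell r + j = \sum_(0 <= r < i') ell r + j' ->
  i = i' /\ j = j'.
Proof.
move=> lt_j lt_j' e.
have [lt|lt|ei] := ltngtP i i'; last by subst i'; move/addnI: e.
- have := row_index_lt lt lt_j; rewrite e ltnNge leq_addr //.
- have := row_index_lt lt lt_j'; rewrite -e ltnNge leq_addr //.
Qed.

Lemma nth_int_range m k : k < m -> nth (Posz 0) (int_range m) k = Posz k.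
Proof. by move=> km; rewrite (nth_map 0) ?size_iota // nth_iota. Qed.

(** * J, G and H as twin arrays *)

Lemma J_array_twin n : twin_array 1 0 id (J_array n (int_range (n ^ 2))).
Proof.
have JE (i j : 'I_n) : J_array n (int_range (n ^ 2)) i j =
    Some (Posz (\sum_(0 <= r < i) n + j)).
  have rowE m : m * n = \sum_(0 <= r < m) n by rewrite sum_nat_const_nat subn0.
  (* The index precedes the start of the fictitious row [n], so [nth] never returns its default. *)
  by rewrite mxE -mulnn !rowE nth_int_range // (row_index_lt (ell := fun=> n)).
split=> //.
- move=> k; apply/eqP; rewrite cards_eq0; apply/eqP/setP => j.
  by rewrite !inE JE.
- move=> [i j] [k l] s; rewrite /entry !JE /= => <- [].
  by move/(@row_index_inj (fun=> n)) => [] // /val_inj-> /val_inj->; left.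
- by move=> c _; rewrite setUid cards1.
- by move=> c _; rewrite eqxx.
Qed.

(** [tau] is the reflection in the graph of [alpha], where the stars are. The corners of a cell and
    its mirror image lie on that graph. *)
Lemma mirror_twin n (alpha : 'I_n -> 'I_n) (P : array n n) :
    involutive alpha ->
    (forall i j, (P i j == None) = (j == alpha i)) ->
    (forall i j, P (alpha j) (alpha i) = P i j) ->
    (forall i j k l s, P i j = Some s -> P k l = Some s ->
      (k, l) = (i, j) \/ (k, l) = (alpha j, alpha i)) ->
  twin_array 2 1 (fun c => (alpha c.2, alpha c.1)) P.
Proof.
move=> alphaK starE mirrorE P_inj; split.
- move=> k; rewrite -(cards1 (alpha k)); apply: eq_card => j.
  by rewrite !inE starE [RHS]eq_sym -(inj_eq (inv_inj alphaK)) alphaK.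
- by move=> c; rewrite /entry /= mirrorE.
- by move=> [i j] [k l] s; apply: P_inj.
- move=> [i j]; rewrite /entry starE /= => ne; rewrite cards2.
  by rewrite xpair_eqE negb_and [j == _]eq_sym (eq_sym _ j) ne orbT.
- move=> [i j] _ _ /=; split; apply/eqP; first by rewrite starE.
  by rewrite starE alphaK.
Qed.

Lemma sum_ord_double n : \sum_(0 <= r < n + n) r = n * (2 * n - 1).
Proof.
by rewrite bin2_sum bin2 addnn -doubleMl doubleK subn1 mul2n.
Qed.

Lemma G_array_twin n : twin_array 2 1
  (fun c => (rev_ord c.2, rev_ord c.1))
  (G_array (n + n) (int_range (n * (2 * n - 1)))).
Proof.
set N := n + n; set P := G_array _ _.
pose lab (i j : 'I_N) := \sum_(0 <= r < i) (N.-1 - r) + j.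
(* Row [r] has [N.-1 - r] cells above the anti-diagonal; reversing the sum gives the size of the
   integer list. *)
have sumE : n * (2 * n - 1) = \sum_(0 <= r < N) (N.-1 - r).
  rewrite -sum_ord_double big_nat_rev /=; apply: eq_big_nat => r /andP[_ lt_r].
  by rewrite add0n; lia.
have PE (i j : 'I_N) : P i j =
    if j == rev_ord i then None
    else if i + j < N.-1 then Some (Posz (lab i j))
    else Some (Posz (lab (rev_ord j) (rev_ord i))).
  rewrite mxE; have [//|ne] := eqVneq j (rev_ord i).
  have {}ne : i + j != N.-1.
    by apply: contraNneq ne => e; apply/eqP/val_inj => /=; lia.
  have [iN jN] := (ltn_ord i, ltn_ord j).
  by case: ifP => lt; rewrite nth_int_range // sumE row_index_lt //=; lia.
have lab_inj (i j k l : 'I_N) : i + j < N.-1 -> k + l < N.-1 ->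
    lab i j = lab k l -> (k, l) = (i, j).
  move=> ij kl /(@row_index_inj (fun r => N.-1 - r))[]; try lia.
  by move=> /val_inj-> /val_inj->.
apply: mirror_twin.
- exact: rev_ordK.
- by move=> i j; rewrite PE; case: ifP => //; case: ifP.
- move=> i j; rewrite !PE !rev_ordK [rev_ord i == j]eq_sym.
  have [//|ne] := eqVneq j (rev_ord i).
  have {}ne : i + j != N.-1.
    by apply: contraNneq ne => e; apply/eqP/val_inj => /=; lia.
  (* Reflection replaces [i + j] by [2 * N.-1 - (i + j)], exchanging the two sides of the
     anti-diagonal. *)
  have -> : (rev_ord j + rev_ord i < N.-1) = ~~ (i + j < N.-1).
    by have [iN jN] := (ltn_ord i, ltn_ord j); rewrite /=; lia.
  by case: (i + j < N.-1).
- move=> i j k l s; rewrite !PE.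
  have [//|ne1] := eqVneq j (rev_ord i); have [//|ne2] := eqVneq l (rev_ord k).
  have rev_lt (a b : 'I_N) : b != rev_ord a -> (a + b < N.-1) = false ->
      rev_ord b + rev_ord a < N.-1.
    move=> ne; have {}ne : a + b != N.-1.
      by apply: contraNneq ne => e; apply/eqP/val_inj => /=; lia.
    by have [aN bN] := (ltn_ord a, ltn_ord b); rewrite /=; lia.
  case: ifP => h1 [<-]; case: ifP => h2 [] /esym.
  + by move/lab_inj => ->; [left|..].
  + move/lab_inj => /(_ h1 (rev_lt _ _ ne2 h2)) [<- <-].
    by rewrite !rev_ordK; right.
  + by move/lab_inj => /(_ (rev_lt _ _ ne1 h1) h2) ->; right.
  + move/lab_inj => /(_ (rev_lt _ _ ne1 h1) (rev_lt _ _ ne2 h2)).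
    move=> e; have /= /rev_ord_inj -> := congr1 fst e.
    by have /= /rev_ord_inj -> := congr1 snd e; left.
Qed.

Lemma H_array_twin n : twin_array 2 1 (fun c => (c.2, c.1))
  (H_array (n + n) (int_range (n * (2 * n - 1)))).
Proof.
set N := n + n; set P := H_array _ _.
pose lab (i j : 'I_N) := \sum_(0 <= r < i) r + j.
have PE (i j : 'I_N) : P i j =
    if i == j then None else
    if j < i then Some (Posz (lab i j)) else Some (Posz (lab j i)).
  rewrite mxE; have [//|ne] := eqVneq i j.
  rewrite -sum_ord_double.
  have [lt|lt|/val_inj e] := ltngtP j i; last by rewrite e eqxx in ne.
    by rewrite nth_int_range // (row_index_lt (ell := id)).
  by rewrite nth_int_range // (row_index_lt (ell := id)).
have lab_inj (i j k l : 'I_N) : j < i -> l < k ->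
    lab i j = lab k l -> (k, l) = (i, j).
  by move=> ij kl /(@row_index_inj id)[] // /val_inj-> /val_inj->.
apply: (@mirror_twin _ id) => //.
- by move=> i j; rewrite PE [j == i]eq_sym; case: ifP => //; case: ifP.
- move=> i j; rewrite !PE [j == i]eq_sym; have [//|ne] := eqVneq i j.
  by have [//|//|/val_inj e] := ltngtP j i; rewrite e eqxx in ne.
- move=> i j k l s; rewrite !PE.
  have [//|ne1] := eqVneq i j; have [//|ne2] := eqVneq k l.
  have lt_sym (a b : 'I_N) : a != b -> (b < a) = false -> a < b.
    by move=> ne; case: ltngtP => // /val_inj e; rewrite e eqxx in ne.
  case: ifP => h1 [<-]; case: ifP => h2 [] /esym/lab_inj.
  + by move=> /(_ h1 h2) ->; left.
  + by move=> /(_ h1 (lt_sym _ _ ne2 h2)) [<- <-]; right.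
  + by move=> /(_ (lt_sym _ _ ne1 h1) h2) ->; right.
  + by move=> /(_ (lt_sym _ _ ne1 h1) (lt_sym _ _ ne2 h2)) [<- <-]; left.
Qed.

(** * Parameters of the liftings and assembly of the theorem *)

Lemma diag_arrayE n t (i j : 'I_n) :
  diag_array n t i j = if j == id i then Some t else None.
Proof. by rewrite mxE eq_sym. Qed.

Lemma antidiag_arrayE n t (i j : 'I_n) :
  antidiag_array n t i j = if j == rev_ord i then Some t else None.
Proof. by rewrite mxE. Qed.

(** In even size the diagonal and anti-diagonal are disjoint, so the rotated line of G or H carries
    no star. *)
Lemma rev_ord_neq n (i : 'I_(n + n)) : rev_ord i != i.
Proof. by apply/eqP => /(congr1 val) /=; have := ltn_ord i; lia. Qed.

Lemma regular_PDA_num h K f Z N h' K' f' Z' S m n (P : array m n) :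
    is_regular_PDA h' K' f' Z' S P -> h' = h -> K' = K -> f' = f -> Z' = Z ->
    0 < h -> K * (f - Z) = N * h ->
  is_regular_PDA_num h K f Z N P.
Proof.
move=> PS eh eK ef eZ; subst h' K' f' Z' => h0 eN; exists S => //; apply/eqP.
by rewrite -(eqn_pmul2r h0) (regular_PDA_card PS) eN.
Qed.

Lemma J_array_rotations g t (delta f : 'I_g -> 'I_g) pi (Pstar : array g g) :
    0 < g -> injective delta -> injective f ->
    (forall k l i, k < g -> l < g -> k != l -> iter l f i != iter k f i) ->
    pi =1 rotate delta f ->
    (forall i j, Pstar i j = if j == delta i then Some t else None) ->
  let Ps := powers g pi (J_array g (int_range (g ^ 2))) in
  [/\ injective Ps, (forall k, is_gPDA 1 (Ps k))
    & Blackburn_compatible_family Ps Pstar] /\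
  (forall L, is_lifting_of_I Ps Pstar L ->
     is_regular_PDA_num g (g ^ 2) (g ^ 2) (g ^ 2 + 1 - 2 * g)
       (g * (2 * g - 1)) L).
Proof.
move=> g0 delta_inj f_inj f_free piE PstarE Ps.
have f_free2 k l i : k < g -> l < g -> k != l ->
    iter l f i != iter k f i /\ iter l f i != id (iter k f i).
  by move=> kg lg ne; rewrite f_free.
have P_delta i : J_array g (int_range (g ^ 2)) i (delta i) != None.
  by rewrite mxE.
have [tauK tau_delta f_eps] : [/\ involutive (@id ('I_g * 'I_g)),
    forall i, id (i, delta i) = (id i, delta (id i)) & {morph f : i / id i}] by [].
split.
  by have := powers_family (J_array_twin g) tauK delta_inj tau_delta P_delta g0
    f_inj f_eps f_free2 piE PstarE.
move=> L hL; have g1 : g = 1 * g by rewrite mul1n.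
(* Here [Z = (g - 1) * (g - 1)], leaving [2 * g - 1] non-star cells per column. *)
apply: regular_PDA_num (powers_lifting (J_array_twin g) tauK delta_inj tau_delta
  P_delta g0 f_inj f_eps f_free2 piE PstarE g0 g1 hL) _ _ _ _ _ _ => //; nia.
Qed.

(** Treats G and H together: [alpha] carries the stars, [delta] the rotated line, and they differ by
    [rev_ord], which is thus the action of [tau] on the line. *)
Lemma mirror_rotations g t (alpha delta f : 'I_(g + g) -> 'I_(g + g)) pi
    (P Pstar : array (g + g) (g + g)) :
    0 < g -> twin_array 2 1 (fun c => (alpha c.2, alpha c.1)) P ->
    involutive alpha -> involutive delta ->
    (forall i, alpha i = rev_ord (delta i)) -> {morph delta : i / rev_ord i} ->
    (forall i, P i (delta i) != None) ->
    injective f -> {morph f : i / rev_ord i} ->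
    (forall k l i, k < g -> l < g -> k != l ->
      iter l f i != iter k f i /\ iter l f i != rev_ord (iter k f i)) ->
    pi =1 rotate delta f ->
    (forall i j, Pstar i j = if j == delta i then Some t else None) ->
  let Ps := powers g pi P in
  [/\ 2 <= g -> Blackburn_compatible P (pi P) Pstar,
      [/\ injective Ps, (forall k, is_gPDA 2 (Ps k))
        & Blackburn_compatible_family Ps Pstar] &
      (forall L, is_lifting_of_I Ps Pstar L ->
         is_regular_PDA_num (2 * g) (2 * g ^ 2) (2 * g ^ 2)
           (2 * g ^ 2 + 2 - 3 * g) (g * (3 * g - 2)) L)].
Proof.
move=> g0 P_twin alphaK deltaK alphaE delta_rev P_delta f_inj f_rev f_free piE PstarE Ps.
set tau := fun c => _ in P_twin.
have tauK : involutive tau by move=> [i j]; rewrite /tau /= !alphaK.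
have tau_delta i : tau (i, delta i) = (rev_ord i, delta (rev_ord i)).
  by rewrite /tau /= !alphaE deltaK delta_rev.
have delta_inj := inv_inj deltaK.
have n0 : 0 < g + g by rewrite addn_gt0 g0.
split.
(* Part (a) is compatibility of the powers 0 and 1; [2 <= g] makes 1 a valid exponent. *)
- move=> g2; have := powers_compatible P_twin tauK delta_inj tau_delta P_delta
    f_inj f_rev f_free piE PstarE (k := Ordinal g0) (l := Ordinal g2).
  by apply.
- by have := powers_family P_twin tauK delta_inj tau_delta P_delta n0
    f_inj f_rev f_free piE PstarE.
move=> L hL.
have n2 : g + g = 2 * g by rewrite mul2n addnn.
(* Here [Z = 1 + (g - 1) * (2 * g - 1)], leaving [3 * g - 2] non-star cells per column. *)
apply: regular_PDA_num (powers_lifting P_twin tauK delta_inj tau_delta P_delta n0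
    f_inj f_rev f_free piE PstarE g0 n2 hL) _ _ _ _ _ _; nia.
Qed.

(* Subtractions are on nat; each minuend below is at least its subtrahend when
   1 <= g, whence g ^ 2 + 1 - 2 * g rather than g ^ 2 - 2 * g + 1. *)
Theorem lemma15 (g : nat) (t : int) (g_ge1 : 1 <= g) :
  (* Construction C1 *)
  [/\ (2 <= g -> forall P : array g g, is_gPDA 1 P ->
         t \notin integers_of P ->
         Blackburn_compatible P (piD1 P) (diag_array g t) /\
         Blackburn_compatible P (piAD1 P) (antidiag_array g t)),
      (forall P : array g g, P = J_array g (int_range (g ^ 2)) ->
         t \notin integers_of P ->
         [/\ injective (powers g (@piD1 g) P),
             (forall k, is_gPDA 1 (powers g (@piD1 g) P k))
           & Blackburn_compatible_family
               (powers g (@piD1 g) P) (diag_array g t)] /\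
         [/\ injective (powers g (@piAD1 g) P),
             (forall k, is_gPDA 1 (powers g (@piAD1 g) P k))
           & Blackburn_compatible_family
               (powers g (@piAD1 g) P) (antidiag_array g t)])
    & (forall P : array g g, P = J_array g (int_range (g ^ 2)) ->
         t \notin integers_of P ->
         (forall L,
            is_lifting_of_I (powers g (@piD1 g) P) (diag_array g t) L ->
            is_regular_PDA_num g
              (g ^ 2) (g ^ 2) (g ^ 2 + 1 - 2 * g) (g * (2 * g - 1)) L) /\
         (forall L,
            is_lifting_of_I (powers g (@piAD1 g) P) (antidiag_array g t) L ->
            is_regular_PDA_num g
              (g ^ 2) (g ^ 2) (g ^ 2 + 1 - 2 * g) (g * (2 * g - 1)) L))] /\
  (* Construction C2 *)
  (forall Q0 Q1 : array (g + g) (g + g),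
     Q0 = G_array (g + g) (int_range (g * (2 * g - 1))) ->
     Q1 = H_array (g + g) (int_range (g * (2 * g - 1))) ->
     t \notin integers_of Q0 -> t \notin integers_of Q1 ->
     [/\ (2 <= g ->
            Blackburn_compatible Q0 (piD2 Q0) (diag_array (g + g) t) /\
            Blackburn_compatible Q1 (piAD2 Q1) (antidiag_array (g + g) t)),
         [/\ injective (powers g (@piD2 g) Q0),
             (forall k, is_gPDA 2 (powers g (@piD2 g) Q0 k))
           & Blackburn_compatible_family
               (powers g (@piD2 g) Q0) (diag_array (g + g) t)] /\
         [/\ injective (powers g (@piAD2 g) Q1),
             (forall k, is_gPDA 2 (powers g (@piAD2 g) Q1 k))
           & Blackburn_compatible_family
               (powers g (@piAD2 g) Q1) (antidiag_array (g + g) t)]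
       & (forall L,
            is_lifting_of_I
              (powers g (@piD2 g) Q0) (diag_array (g + g) t) L ->
            is_regular_PDA_num (2 * g)
              (2 * g ^ 2) (2 * g ^ 2) (2 * g ^ 2 + 2 - 3 * g)
              (g * (3 * g - 2)) L) /\
         (forall L,
            is_lifting_of_I
              (powers g (@piAD2 g) Q1) (antidiag_array (g + g) t) L ->
            is_regular_PDA_num (2 * g)
              (2 * g ^ 2) (2 * g ^ 2) (2 * g ^ 2 + 2 - 3 * g)
              (g * (3 * g - 2)) L)]).
Proof.
have dinj := @inj_id 'I_g; have rinj := @rev_ord_inj g.
have Sinj := @ordS_inj g; have Pinj := can_inj (@ord_predK g).
have off (n : nat) (delta : 'I_n -> 'I_n) (Pstar : array n n) :
    (forall i j, Pstar i j = if j == delta i then Some t else None) ->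
    forall i j, j != delta i -> Pstar i j = None.
  by move=> PE i j /negPf nj; rewrite PE nj.
have [JD JDL] := J_array_rotations g_ge1 dinj Pinj (@iter_ord_pred_free g)
  (@piD1E g) (@diag_arrayE g t).
have [JA JAL] := J_array_rotations g_ge1 rinj Sinj (@iter_ordS_free g)
  (@piAD1E g) (@antidiag_arrayE g t).
split; first split.
- move=> g2 P hP _.
  (* A single shift has no fixed point once [g] is at least 2: freeness for exponents 0 and 1. *)
  have S_ne i : @ordS g i != i.
    exact: (@iter_ordS_free g 0 1 i (ltnW g2) g2 isT).
  have P_ne i : @ord_pred g i != i.
    exact: (@iter_ord_pred_free g 0 1 i (ltnW g2) g2 isT).
  rewrite piD1E piAD1E; split.
    by apply: rotate_compatible_1PDA hP dinj P_ne (off _ _ _ (@diag_arrayE g t)).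
  by apply: rotate_compatible_1PDA hP rinj S_ne (off _ _ _ (@antidiag_arrayE g t)).
- by move=> P -> _.
- by move=> P -> _.
move=> Q0 Q1 -> -> _ _.
have G_diag i : G_array (g + g) (int_range (g * (2 * g - 1))) i i != None.
  by rewrite mxE [i == _]eq_sym (negPf (rev_ord_neq i)); case: ifP.
have H_antidiag i :
    H_array (g + g) (int_range (g * (2 * g - 1))) i (rev_ord i) != None.
  by rewrite mxE [i == _]eq_sym (negPf (rev_ord_neq i)); case: ifP.
have PS_rev : {morph pair_shift (@ord_pred g) (@ordS g) : i / rev_ord i}.
  exact: pair_shift_rev (@rev_ord_pred g).
have SP_rev : {morph pair_shift (@ordS g) (@ord_pred g) : i / rev_ord i}.
  exact: pair_shift_rev (@rev_ordS g).
have [GC GF GL] := mirror_rotations g_ge1 (G_array_twin g) (@rev_ordK _)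
  (fun=> erefl) (fun=> erefl) (fun=> erefl) G_diag (pair_shift_inj Pinj Sinj)
  PS_rev (iter_pair_shift_free (@iter_ord_pred_free g) (@iter_ordS_free g))
  (@piD2E g) (@diag_arrayE _ t).
have [HC HF HL] := mirror_rotations g_ge1 (H_array_twin g) (fun=> erefl)
  (@rev_ordK _) (fun i => esym (rev_ordK i)) (fun=> erefl) H_antidiag
  (pair_shift_inj Sinj Pinj) SP_rev
  (iter_pair_shift_free (@iter_ordS_free g) (@iter_ord_pred_free g))
  (@piAD2E g) (@antidiag_arrayE _ t).
by split=> // g2; split; [apply: GC | apply: HC].
Qed.
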